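(* Let $K$ be an arbitrary field. The graph $\mathcal{G}_{0,K}$ consists of a unique maximal coclass tree with root $K Z_1$. This tree is strongly virtually periodic with strong defect $1$, strong period $1$, and the single associated polynomial $f_{KZ_1}(x) = 1$.
   Context: Algebras are associative and not necessarily unital. A semigroup with zero or an associative algebra $O$ is nilpotent if there is an integer $c$ such that every product of $c+1$ elements of $O$ is zero; the least such $c$ is the class $cl(O)$, i.e. the length of the series $O > O^2 > \dots > O^c > O^{c+1}=\{0\}$ (the one-element semigroup and the zero algebra have class $0$). The coclass of a finite nilpotent semigroup with $n$ non-zero elements, or of a nilpotent algebra of finite dimension $n$, is $n-cl(O)$. For a semigroup $S$ with zero $z$, the contracted semigroup algebra $KS$ is the quotient of the semigroup algebra $K[S]$ by the ideal $Kz$. $Z_n$ is the zero semigroup with $n$ elements (all products are $0$); so $Z_1$ is the one-element semigroup and $KZ_1$ is the zero algebra. The directed labelled graph $\mathcal{G}_{r,K}$: its vertices correspond one-to-one to the isomorphism types of algebras $KS$, where $S$ ranges over the finite nilpotent semigroups of coclass $r$; there is a directed edge $A \to B$ between vertices if $B/B^c \cong A$, where $c$ is the class of $B$; each vertex $A$ is labelled by the number of isomorphism types of semigroups $S$ of coclass $r$ with $A\cong KS$. Every connected component of $\mathcal{G}_{r,K}$ is a rooted tree. An infinite path is maximal if it starts at the root of its tree. For a vertex $A$, $\mathcal{T}(A)$ is the rooted tree formed by all paths starting at $A$. $\mathcal{T}(A)$ is a coclass tree if it contains a unique maximal infinite path (an infinite path starting at its root $A$); a coclass tree $\mathcal{T}(A)$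 is maximal if either $A$ is a root in $\mathcal{G}_{r,K}$ or the parent of $A$ lies on more than one maximal infinite path. For a labelled tree $\mathcal{T}$, $\overline{\mathcal{T}}$ denotes the tree without labels. Let $\mathcal{T}$ be a maximal coclass tree with maximal infinite path $A_1\to A_2\to\cdots$. $\mathcal{T}$ is strongly virtually periodic with strong defect $l$ and strong period $k$ ($l,k$ positive integers) if there exist a graph isomorphism $\mu:\overline{\mathcal{T}}(A_l)\to\overline{\mathcal{T}}(A_{l+k})$ and, for every vertex $B$ in $\mathcal{T}(A_l)\setminus\mathcal{T}(A_{l+k})$, a rational polynomial $f_B$ such that the label of $\mu^i(B)$ equals $f_B(i)$ for all $i\ge 0$. The $f_B$ are the associated polynomials. *)

(* Defs.v *)
From HB Require Import structures.
From mathcomp Require Import all_boot all_algebra.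
From mathcomp Require Import boolp.
From Stdlib Require Import Relation_Operators.

Set Implicit Arguments.
Unset Strict Implicit.
Unset Printing Implicit Defensive.

Import GRing.Theory.

Local Open Scope ring_scope.
Local Open Scope quotient_scope.

Section NilpotencyClass.
Variable G : magmaType.

(* [x] is a product of [c] elements; there are none for [c = 0]. *)
Definition is_product (c : nat) (x : G) : Prop :=
  exists (a : G) (s : seq G), (size s).+1 = c /\ x = foldl *%g a s.

Variable z : G.

Definition products_vanish (c : nat) : Prop :=
  forall x : G, is_product c.+1 x -> x = z.

(* Having a class at all amounts to being nilpotent. *)
Definition has_class (c : nat) : Prop :=
  products_vanish c /\ forall c', products_vanish c' -> (c <= c')%N.

End NilpotencyClass.

HB.mixin Record Semigroup_hasZero S of Semigroup S := {
  zerog : S;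
  mul0g : left_zero zerog (@monoid.mul S);
  mulg0 : right_zero zerog (@monoid.mul S)
}.

#[short(type="finSemigroup0Type")]
HB.structure Definition FinSemigroup0 :=
  {S of Finite S & Semigroup S & Semigroup_hasZero S}.

Definition sgrp_isog (S T : semigroupType) : Prop :=
  exists2 f : S -> T, bijective f & {morph f : x y / (x * y)%g}.

Definition sgrp_coclass (S : finSemigroup0Type) (r : nat) : Prop :=
  exists2 c, has_class (zerog : S) c
           & #|[pred x : S | x != zerog]| = (c + r)%N.

(* The zero semigroup [Z_n], for [n > 0]; the carrier forces [Z_0] to be [Z_1]. *)
Definition zero_sgrp (n : nat) : Type := 'I_n.-1.+1.

HB.instance Definition _ n := Finite.on (zero_sgrp n).

Section ZeroSemigroup.
Variable n : nat.
Definition zero_mul (_ _ : zero_sgrp n) : zero_sgrp n := ord0.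

Fact zmulA : associative zero_mul. Proof. by []. Qed.
HB.instance Definition _ := isSemigroup.Build (zero_sgrp n) zmulA.

Fact zmul0g : left_zero (ord0 : zero_sgrp n) (@monoid.mul (zero_sgrp n)).
Proof. by []. Qed.
Fact zmulg0 : right_zero (ord0 : zero_sgrp n) (@monoid.mul (zero_sgrp n)).
Proof. by []. Qed.
HB.instance Definition _ :=
  Semigroup_hasZero.Build (zero_sgrp n) zmul0g zmulg0.
End ZeroSemigroup.

(* Associative, not necessarily unital algebras; the product is [*%g]. *)
HB.mixin Record Lmodule_Semigroup_isNuAlgebra (K : fieldType) A
    of GRing.Lmodule K A & Semigroup A := {
  numulDl : left_distributive (@monoid.mul A) +%R;
  numulDr : right_distributive (@monoid.mul A) +%R;
  numulZl : forall (k : K) (x y : A), ((k *: x) * y)%g = k *: (x * y)%g;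
  numulZr : forall (k : K) (x y : A), (x * (k *: y))%g = k *: (x * y)%g
}.

#[short(type="nualgType")]
HB.structure Definition NuAlgebra (K : fieldType) :=
  {A of GRing.Lmodule K A & Semigroup A & Lmodule_Semigroup_isNuAlgebra K A}.

Definition nualg_isog (K : fieldType) (A B : nualgType K) : Prop :=
  exists f : A -> B, [/\ bijective f, linear f & {morph f : x y / (x * y)%g}].

Section NuAlgebraTheory.
Variables (K : fieldType) (A : nualgType K).
Implicit Types x y : A.

Lemma numul0l x : ((0 : A) * x)%g = 0.
Proof. by rewrite -{1}(scale0r (0 : A)) numulZl scale0r. Qed.
Lemma numul0r x : (x * (0 : A))%g = 0.
Proof. by rewrite -{1}(scale0r (0 : A)) numulZr scale0r. Qed.
Lemma numulNl x y : ((- x) * y)%g = - (x * y)%g.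
Proof. by rewrite -scaleN1r numulZl scaleN1r. Qed.
Lemma numulNr x y : (x * (- y))%g = - (x * y)%g.
Proof. by rewrite -scaleN1r numulZr scaleN1r. Qed.
Lemma numulBl x y z : ((x - y) * z)%g = (x * z)%g - (y * z)%g.
Proof. by rewrite numulDl numulNl. Qed.
Lemma numulBr x y z : (x * (y - z))%g = (x * y)%g - (x * z)%g.
Proof. by rewrite numulDr numulNr. Qed.
Lemma numul_suml (I : Type) (r : seq I) (P : pred I) (F : I -> A) x :
  ((\sum_(i <- r | P i) F i) * x)%g = \sum_(i <- r | P i) (F i * x)%g.
Proof.
by elim/big_rec2: _ => [|i u v _ <-]; rewrite ?numul0l // numulDl.
Qed.
Lemma numul_sumr (I : Type) (r : seq I) (P : pred I) (F : I -> A) x :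
  (x * (\sum_(i <- r | P i) F i))%g = \sum_(i <- r | P i) (x * F i)%g.
Proof.
by elim/big_rec2: _ => [|i u v _ <-]; rewrite ?numul0r // numulDr.
Qed.
End NuAlgebraTheory.

Record nuideal (K : fieldType) (A : nualgType K) := NuIdeal {
  nuideal_mem :> {pred A};
  nuideal_submod : submod_closed nuideal_mem;
  nuidealMl : forall a x : A, x \in nuideal_mem -> (a * x)%g \in nuideal_mem;
  nuidealMr : forall a x : A, x \in nuideal_mem -> (x * a)%g \in nuideal_mem
}.

HB.instance Definition _ (K : fieldType) (A : nualgType K) (I : nuideal A) :=
  GRing.isSubmodClosed.Build K A (nuideal_mem I)
    (GRing.submod_closed_semi (nuideal_submod I)).

Definition nuquot (K : fieldType) (A : nualgType K) (I : nuideal A) : Type :=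
  Quotient.quot I.

Section NuQuotient.
Variables (K : fieldType) (A : nualgType K) (I : nuideal A).
Local Notation Q := (nuquot I).

HB.instance Definition _ := GRing.Zmodule.on Q.
HB.instance Definition _ := EqQuotient.on Q.

Let piE0 (x y : A) : (\pi_Q x = \pi_Q y) <-> (x - y \in I).
Proof.
rewrite [_ \in I](Quotient.idealrBE I); split=> [xy|/eqP//].
by apply/eqP.
Qed.

Let repr_in (x : A) : x - repr (\pi_Q x) \in I.
Proof. by apply/piE0; rewrite reprK. Qed.

Definition nuquot_scale (k : K) (x : Q) : Q := \pi_Q (k *: repr x).
Definition nuquot_mul (x y : Q) : Q := \pi_Q (repr x * repr y)%g.

Let pi_scale k x : nuquot_scale k (\pi_Q x) = \pi_Q (k *: x).
Proof. by apply/esym/piE0; rewrite -scalerBr rpredZ ?repr_in. Qed.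

Let pi_mul x y : nuquot_mul (\pi_Q x) (\pi_Q y) = \pi_Q (x * y)%g.
Proof.
apply/esym/piE0.
rewrite -(subrKA (x * repr (\pi_Q y))%g) -numulBr -numulBl.
by rewrite rpredD //; [apply: nuidealMl | apply: nuidealMr]; apply: repr_in.
Qed.

Let pi_add x y : \pi_Q x + \pi_Q y = \pi_Q (x + y).
Proof. exact: esym (Quotient.pi_add I x y). Qed.

Fact qscalerA a b (v : Q) : nuquot_scale a (nuquot_scale b v) = nuquot_scale (a * b) v.
Proof. by rewrite -[v]reprK [nuquot_scale b _]pi_scale !pi_scale scalerA. Qed.
Fact qscale1r : left_id 1 nuquot_scale.
Proof. by move=> v; rewrite -[v]reprK pi_scale scale1r. Qed.
Fact qscalerDr : right_distributive nuquot_scale +%R.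
Proof.
move=> a u v; rewrite -[u]reprK -[v]reprK pi_add !pi_scale pi_add.
by rewrite scalerDr.
Qed.
Fact qscalerDl (v : Q) : {morph nuquot_scale^~ v : a b / a + b}.
Proof.
by move=> a b; rewrite -[v]reprK !pi_scale pi_add scalerDl.
Qed.
HB.instance Definition _ := GRing.Zmodule_isLmodule.Build K Q
  qscalerA qscale1r qscalerDr qscalerDl.

Fact qmulA : associative nuquot_mul.
Proof.
move=> x y z; rewrite -[x]reprK -[y]reprK -[z]reprK.
rewrite (pi_mul (repr y) (repr z)) (pi_mul (repr x) (repr y)).
by rewrite (pi_mul (repr x)) (pi_mul _ (repr z)) mulgA.
Qed.
HB.instance Definition _ := isSemigroup.Build Q qmulA.

Lemma pi_nuquotE (x y : A) : (\pi_Q x = \pi_Q y) <-> (x - y \in I).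
Proof. exact: piE0. Qed.
Lemma pi_nuquotD (x y : A) : \pi_Q (x + y) = \pi_Q x + \pi_Q y.
Proof. exact: esym (pi_add x y). Qed.
Lemma pi_nuquotZ (k : K) (x : A) : \pi_Q (k *: x) = k *: \pi_Q x.
Proof. exact: esym (pi_scale k x). Qed.
Lemma pi_nuquotM (x y : A) : \pi_Q (x * y)%g = (\pi_Q x * \pi_Q y)%g.
Proof. exact: esym (pi_mul x y). Qed.

Fact qmulDl : left_distributive (@monoid.mul Q) +%R.
Proof.
move=> x y z; rewrite -[x]reprK -[y]reprK -[z]reprK.
by rewrite -pi_nuquotD -!pi_nuquotM -pi_nuquotD numulDl.
Qed.
Fact qmulDr : right_distributive (@monoid.mul Q) +%R.
Proof.
move=> x y z; rewrite -[x]reprK -[y]reprK -[z]reprK.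
by rewrite -pi_nuquotD -!pi_nuquotM -pi_nuquotD numulDr.
Qed.
Fact qmulZl (k : K) (x y : Q) : ((k *: x) * y)%g = k *: (x * y)%g.
Proof.
rewrite -[x]reprK -[y]reprK.
by rewrite -pi_nuquotZ -!pi_nuquotM -pi_nuquotZ numulZl.
Qed.
Fact qmulZr (k : K) (x y : Q) : (x * (k *: y))%g = k *: (x * y)%g.
Proof.
rewrite -[x]reprK -[y]reprK.
by rewrite -pi_nuquotZ -!pi_nuquotM -pi_nuquotZ numulZr.
Qed.
HB.instance Definition _ := Lmodule_Semigroup_isNuAlgebra.Build K Q
  qmulDl qmulDr qmulZl qmulZr.

End NuQuotient.

(* [B^c], the linear span of the products of [c] elements, for [c > 0]. *)
Section AlgebraPower.
Variables (K : fieldType) (B : nualgType K) (c : nat).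

Definition nupower_mem : {pred B} := fun x =>
  `[< exists (n : nat) (k : 'I_n -> K) (p : 'I_n -> B),
        (forall i, is_product c (p i)) /\ x = \sum_(i < n) k i *: p i >].

Let powP x : reflect (exists (n : nat) (k : 'I_n -> K) (p : 'I_n -> B),
  (forall i, is_product c (p i)) /\ x = \sum_(i < n) k i *: p i)
  (x \in nupower_mem).
Proof. exact: asboolP. Qed.

Fact nupower_submod : submod_closed nupower_mem.
Proof.
split.
  by apply/powP; exists 0%N, (fun=> 0), (fun=> 0); rewrite big_ord0; split=> // -[].
move=> a _ _ /powP[n [k [p [pP ->]]]] /powP[m [l [q [qP ->]]]].
apply/powP; exists (n + m)%N.
exists (fun i => match fintype.split i with inl i => a * k i | inr j => l j end).
exists (fun i => match fintype.split i with inl i => p i | inr j => q j end).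
split=> [i|]; first by case: fintype.split.
rewrite big_split_ord /= scaler_sumr; congr (_ + _); apply: eq_bigr => i _.
  by rewrite (unsplitK (inl i)) scalerA.
by rewrite (unsplitK (inr i)).
Qed.

Let productMl (a x : B) : is_product c x -> is_product c (a * x)%g.
Proof.
case=> b [s [<- ->]]; exists (a * b)%g, s; split=> //.
by elim: s b => //= y s IHs b; rewrite IHs mulgA.
Qed.

Let productMr (a x : B) : is_product c x -> is_product c (x * a)%g.
Proof.
case=> b [s [<- ->]]; case/lastP: s => [|s y]; first by exists (b * a)%g, [::].
exists b, (rcons s (y * a)%g); rewrite !size_rcons; split=> //.
by rewrite !foldl_rcons mulgA.
Qed.

Fact nupowerMl (a x : B) : x \in nupower_mem -> (a * x)%g \in nupower_mem.
Proof.
move=> /powP[n [k [p [pP ->]]]]; apply/powP.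
exists n, k, (fun i => (a * p i)%g); split=> [i|]; first exact: productMl.
by rewrite numul_sumr; apply: eq_bigr => i _; rewrite numulZr.
Qed.

Fact nupowerMr (a x : B) : x \in nupower_mem -> (x * a)%g \in nupower_mem.
Proof.
move=> /powP[n [k [p [pP ->]]]]; apply/powP.
exists n, k, (fun i => (p i * a)%g); split=> [i|]; first exact: productMr.
by rewrite numul_suml; apply: eq_bigr => i _; rewrite numulZl.
Qed.

Definition nupower : nuideal B := NuIdeal nupower_submod nupowerMl nupowerMr.
End AlgebraPower.

Definition sgrp_alg (K : fieldType) (S : finSemigroup0Type) : Type :=
  {ffun S -> K^o}.

Section SemigroupAlgebra.
Variables (K : fieldType) (S : finSemigroup0Type).
Local Notation KS := (sgrp_alg K S).

HB.instance Definition _ := GRing.Lmodule.copy KS {ffun S -> K^o}.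

Definition sgrp_basis (u : S) : KS := [ffun v => (v == u)%:R].

Definition sgrp_alg_mul (f g : KS) : KS :=
  \sum_(u : S) \sum_(v : S) (f u * g v) *: sgrp_basis (u * v)%g.

Let smulDl : left_distributive sgrp_alg_mul +%R.
Proof.
move=> f g h; rewrite /sgrp_alg_mul -big_split; apply: eq_bigr => u _.
rewrite -big_split; apply: eq_bigr => v _.
by rewrite /= -scalerDl ffunE mulrDl.
Qed.

Let smulDr : right_distributive sgrp_alg_mul +%R.
Proof.
move=> f g h; rewrite /sgrp_alg_mul -big_split; apply: eq_bigr => u _.
rewrite -big_split; apply: eq_bigr => v _.
by rewrite /= -scalerDl ffunE mulrDr.
Qed.

Let smulZl (k : K) (f g : KS) : sgrp_alg_mul (k *: f) g = k *: sgrp_alg_mul f g.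
Proof.
rewrite /sgrp_alg_mul scaler_sumr; apply: eq_bigr => u _.
rewrite scaler_sumr; apply: eq_bigr => v _.
by rewrite scalerA ffunE mulrA.
Qed.

Let smulZr (k : K) (f g : KS) : sgrp_alg_mul f (k *: g) = k *: sgrp_alg_mul f g.
Proof.
rewrite /sgrp_alg_mul scaler_sumr; apply: eq_bigr => u _.
rewrite scaler_sumr; apply: eq_bigr => v _.
by rewrite scalerA ffunE mulrCA.
Qed.

Lemma sgrp_algE (f : KS) : f = \sum_(u : S) f u *: sgrp_basis u.
Proof.
apply/ffunP => v; rewrite sum_ffunE (bigD1 v) //= big1 => [|u /negPf uv].
  by rewrite !ffunE eqxx [_ *: _]mulr1 addr0.
by rewrite !ffunE eq_sym uv [_ *: _]mulr0.
Qed.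

Let smul_basis (u v : S) :
  sgrp_alg_mul (sgrp_basis u) (sgrp_basis v) = sgrp_basis (u * v)%g.
Proof.
rewrite /sgrp_alg_mul (bigD1 u) //= [X in _ + X]big1 => [|w /negPf wu].
  rewrite addr0 (bigD1 v) //= [X in _ + X]big1 => [|w /negPf wv].
    by rewrite !ffunE !eqxx mulr1 scale1r addr0.
  by rewrite !ffunE wv mulr0 scale0r.
by rewrite big1 // => v' _; rewrite !ffunE wu mul0r scale0r.
Qed.

Let smul0l g : sgrp_alg_mul 0 g = 0.
Proof. by rewrite -(scale0r (0 : KS)) smulZl !scale0r. Qed.
Let smul0r g : sgrp_alg_mul g 0 = 0.
Proof. by rewrite -(scale0r (0 : KS)) smulZr !scale0r. Qed.
Let smul_suml (F : S -> KS) g :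
  sgrp_alg_mul (\sum_u F u) g = \sum_u sgrp_alg_mul (F u) g.
Proof. by elim/big_rec2: _ => [|i u v _ <-]; rewrite ?smul0l // smulDl. Qed.
Let smul_sumr (F : S -> KS) g :
  sgrp_alg_mul g (\sum_u F u) = \sum_u sgrp_alg_mul g (F u).
Proof. by elim/big_rec2: _ => [|i u v _ <-]; rewrite ?smul0r // smulDr. Qed.

Fact smulA : associative sgrp_alg_mul.
Proof.
move: (smulZl) (smulZr) (smul_suml) (smul_sumr) (smul_basis).
move: sgrp_alg_mul => m mZl mZr m_suml m_sumr m_basis f g h.
rewrite (sgrp_algE f) (sgrp_algE g) (sgrp_algE h).
rewrite !m_suml; apply: eq_bigr => u _; rewrite !mZl.
congr (_ *: _); rewrite !(m_sumr _ (sgrp_basis u)) m_suml.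
apply: eq_bigr => v _; rewrite !(mZl, mZr); congr (_ *: _).
rewrite m_basis !m_sumr; apply: eq_bigr => w _.
by rewrite !mZr !m_basis mulgA.
Qed.

HB.instance Definition _ := isSemigroup.Build KS smulA.
HB.instance Definition _ := Lmodule_Semigroup_isNuAlgebra.Build K KS
  smulDl smulDr smulZl smulZr.

Lemma sgrp_basisM (u v : S) :
  (sgrp_basis u * sgrp_basis v)%g = sgrp_basis (u * v)%g.
Proof. exact: smul_basis. Qed.

(* The ideal [K z], for [z] the zero of [S]. *)
Definition zero_line_mem : {pred KS} :=
  fun f => `[< exists k : K, f = k *: sgrp_basis zerog >].

Let lineP f : reflect (exists k : K, f = k *: sgrp_basis zerog)
  (f \in zero_line_mem).
Proof. exact: asboolP. Qed.

Fact zero_line_submod : submod_closed zero_line_mem.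
Proof.
split=> [|a _ _ /lineP[k ->] /lineP[l ->]]; apply/lineP.
  by exists 0; rewrite scale0r.
by exists (a * k + l); rewrite scalerDl scalerA.
Qed.

Fact zero_lineMl (a x : KS) :
  x \in zero_line_mem -> (a * x)%g \in zero_line_mem.
Proof.
move=> /lineP[k ->]; apply/lineP; exists (k * \sum_u a u).
rewrite numulZr {1}(sgrp_algE a) numul_suml -scalerA scaler_suml.
by congr (_ *: _); apply: eq_bigr => u _; rewrite numulZl sgrp_basisM mulg0.
Qed.

Fact zero_lineMr (a x : KS) :
  x \in zero_line_mem -> (x * a)%g \in zero_line_mem.
Proof.
move=> /lineP[k ->]; apply/lineP; exists (k * \sum_u a u).
rewrite numulZl {1}(sgrp_algE a) numul_sumr -scalerA scaler_suml.
by congr (_ *: _); apply: eq_bigr => u _; rewrite numulZr sgrp_basisM mul0g.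
Qed.

Definition zero_line : nuideal KS :=
  NuIdeal zero_line_submod zero_lineMl zero_lineMr.
End SemigroupAlgebra.

Definition contracted_alg (K : fieldType) (S : finSemigroup0Type) :
  nualgType K := nuquot (zero_line K S).

Record labelled_digraph := LabelledDigraph {
  vertex :> Type;
  edge : vertex -> vertex -> Prop;
  (* [has_label A n]: the vertex [A] is labelled by [n]. *)
  has_label : vertex -> nat -> Prop
}.

Section CoclassGraph.
Variables (r : nat) (K : fieldType).

Definition iso_type (A : nualgType K) : nualgType K -> Prop :=
  fun B => nualg_isog A B.

Definition coclass_vertex : Type :=
  {C : nualgType K -> Prop | exists2 S : finSemigroup0Type,
     sgrp_coclass S r & C = iso_type (contracted_alg K S)}.

Definition vertex_of (S : finSemigroup0Type) (Sr : sgrp_coclass S r) :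
    coclass_vertex :=
  exist _ (iso_type (contracted_alg K S)) (ex_intro2 _ _ S Sr erefl).

(* Without [0 < c] the zero algebra, of class 0, would carry a loop. *)
Definition coclass_edge (A B : coclass_vertex) : Prop :=
  exists (b : nualgType K) (c : nat),
    [/\ sval B b, has_class (0 : b) c, (0 < c)%N
      & sval A (nuquot (nupower b c))].

(* [n] is the number of isomorphism types of the semigroups [T] below: there
   is an irredundant system of representatives indexed by ['I_n]. *)
Definition coclass_label (A : coclass_vertex) (n : nat) : Prop :=
  let in_A (T : finSemigroup0Type) :=
    sgrp_coclass T r /\ sval A (contracted_alg K T) in
  exists S : 'I_n -> finSemigroup0Type,
    [/\ forall i, in_A (S i),
        forall i j, sgrp_isog (S i) (S j) -> i = j
      & forall T, in_A T -> exists i, sgrp_isog T (S i)].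

Definition coclass_graph : labelled_digraph :=
  LabelledDigraph coclass_edge coclass_label.
End CoclassGraph.

Section CoclassTrees.
Variable G : labelled_digraph.
Implicit Types (A B : G) (p q : nat -> G).

Definition is_root A : Prop := forall B, ~ edge B A.

(* The vertex set of T(A). *)
Definition tree A B : Prop := clos_refl_trans G (@edge G) A B.

Definition is_rooted_tree A : Prop :=
  (forall B, tree A B -> ~ edge B A) /\
  (forall B C D, tree A B -> tree A C -> edge B D -> edge C D -> B = C).

Definition infinite_path p : Prop := forall i, edge (p i) (p i.+1).

Definition infinite_path_from A p : Prop := infinite_path p /\ p 0%N = A.

Definition maximal_infinite_path p : Prop := infinite_path p /\ is_root (p 0%N).

Definition coclass_tree A : Prop :=
  is_rooted_tree A /\ exists! p, infinite_path_from A p.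

Definition maximal_coclass_tree A : Prop :=
  coclass_tree A /\
  (is_root A \/
   exists B, edge B A /\
     exists p q, [/\ maximal_infinite_path p, maximal_infinite_path q, p <> q,
       exists i, p i = B & exists j, q j = B]).

(* [mu] restricts to an isomorphism between the subgraphs induced on [X], [Y];
   its values outside [X] are irrelevant. *)
Definition graph_isomorphism (X Y : G -> Prop) (mu : G -> G) : Prop :=
  [/\ forall B, X B -> Y (mu B),
      forall B C, X B -> X C -> mu B = mu C -> B = C,
      forall C, Y C -> exists2 B, X B & mu B = C
    & forall B C, X B -> X C -> (edge B C <-> edge (mu B) (mu C))].

(* With the path written [A_1 -> A_2 -> ...], [A_i] is [p i.-1]; [f B] is the
   polynomial [f_B], relevant only for [B] in T(A_l) \ T(A_(l+k)). *)
Definition strongly_virtually_periodic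
    A (l k : nat) (f : G -> {poly rat}) : Prop :=
  [/\ (0 < l)%N, (0 < k)%N &
   exists p, infinite_path_from A p /\
   exists mu : G -> G,
     graph_isomorphism (tree (p l.-1)) (tree (p (l + k).-1)) mu /\
     forall B, tree (p l.-1) B -> ~ tree (p (l + k).-1) B ->
     forall i : nat, exists2 n, has_label (iter i mu B) n
                              & (f B).[i%:R] = n%:R].
End CoclassTrees.

Fact zero_sgrp1_coclass : sgrp_coclass (zero_sgrp 1) 0.
Proof.
exists 0%N; last by apply: eq_card0 => x; rewrite !inE [x]ord1 eqxx.
by split=> // x _; apply: val_inj; case: x => -[].
Qed.

Definition KZ1 (K : fieldType) : coclass_graph 0 K :=
  vertex_of K zero_sgrp1_coclass.

(* Main.v *)
Require Import Defs.
From HB Require Import structures.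
From mathcomp Require Import all_boot all_algebra.
From mathcomp Require Import boolp zify.
From Stdlib Require Import Relation_Operators.

Import GRing.Theory.
Local Open Scope ring_scope.

(** The graph of coclass 0 is a single ray indexed by the class.

    Let [S] have class [c > 0] and exactly [c] non-zero elements, and choose a
    non-zero product [y_1 * ... * y_c].  Its [c] prefixes are non-zero, and they
    are distinct, because in a nilpotent semigroup [x = x * w] forces [x = 0];
    hence they are all the non-zero elements of [S] ([prefix_onto]).  All of them
    but [y_1] are products of two elements.  A factor [y_j] that is a product of
    two elements would make the chosen product one of [c + 1] elements, that is
    zero; so every [y_j] is [y_1] ([longest_product_const]).  Hence
    [S = {a, a^2, ..., a^c, 0}]: there is one semigroup of coclass 0 for each
    class, up to isomorphism.

    Its contracted algebra is [x K[x] / (x^(c+1))], an algebra of class [c] whose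
    quotient by its [c]-th power is the same algebra for [c - 1].  To avoid
    building that algebra, the predicate [truncated c] says that an algebra is the
    image of [K[x]] under the linear map sending [p] to the class of [x * p]; it
    is a complete isomorphism invariant, so a vertex is the predicate [truncated c]
    for its [c].  Therefore the vertices [A_0 = K Z_1, A_1, A_2, ...] are pairwise
    distinct, the edges are exactly [A_c -> A_(c+1)], and all labels are 1.  What
    remains is a statement about an arbitrary ray ([is_ray]): it is its own only
    maximal infinite path, and the shift [A_c -> A_(c+1)] is the required
    isomorphism from T(A_0) onto T(A_1), which leaves out the root alone. *)

(** * Semigroups of coclass 0 *)

Section Products.
Context {S : semigroupType}.
Implicit Types (a b x y : S) (s t : seq S).

Lemma foldl_mulg a s b t :
  (foldl *%g a s * foldl *%g b t)%g = foldl *%g a (s ++ b :: t).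
Proof.
rewrite foldl_cat /=; elim/last_ind: t => //= t y IHt.
by rewrite !foldl_rcons mulgA IHt.
Qed.

(** The power [a^(n+1)]: a semigroup has no [a^0], whence the shift. *)
Definition spow a n : S := foldl *%g a (nseq n a).

Lemma spow_product a n : is_product n.+1 (spow a n).
Proof. by exists a, (nseq n a); rewrite size_nseq. Qed.

Lemma spowD a m n : (spow a m * spow a n)%g = spow a (m + n).+1.
Proof. by rewrite foldl_mulg -addnS /spow nseqD. Qed.

End Products.

Section NilpotentSemigroup.
Context {S : finSemigroup0Type}.
Implicit Types (a x y : S) (s t : seq S).

Lemma foldl_zero s : foldl *%g (zerog : S) s = zerog.
Proof. by elim: s => //= y s; rewrite mul0g. Qed.

Lemma spow_ge {a c i} : spow a c = zerog -> (c <= i)%N -> spow a i = zerog.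
Proof.
move=> ac0 /subnKC <-; case: (i - c)%N => [|n]; first by rewrite addn0.
by rewrite addnS -spowD ac0 mul0g.
Qed.

(** Iterating [x = x * y] writes [x] as an arbitrarily long product. *)
Lemma nilpotent_fix_eq0 {c x} y :
  products_vanish (zerog : S) c -> x = (x * y)%g -> x = zerog.
Proof.
move=> vanish xy; apply: (vanish); exists x, (nseq c y); rewrite size_nseq.
by split=> //; elim: c {vanish} => //= n {1}->; rewrite -xy.
Qed.

(** A prefix that occurs twice would satisfy [x = x * w] and vanish; so the
    [c + 1] prefixes are distinct and, by counting, exhaust the non-zero elements.
    The last clause separates the first letter from the longer prefixes: only
    that letter can fail to be a product of two elements. *)
Lemma prefix_onto {c a s} :
    products_vanish (zerog : S) c.+1 -> #|[pred x : S | x != zerog]| = c.+1 ->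
    size s = c -> foldl *%g a s != zerog ->
  forall x, x != zerog -> exists2 i : 'I_c.+1, x = foldl *%g a (take i s)
    & (i > 0)%N -> is_product 2 x.
Proof.
move=> vanish cardS sz_s prod_neq0 x x_neq0.
pose pre (i : 'I_c.+1) := foldl *%g a (take i s).
have pre_neq0 i : pre i != zerog.
  apply: contraNneq prod_neq0 => pre0; rewrite -(cat_take_drop i s) foldl_cat.
  by rewrite -[foldl _ a _]/(pre i) pre0 foldl_zero.
have take_lt (i j : nat) : (i < j <= c)%N ->
    exists b t, take j s = take i s ++ b :: t.
  move=> /andP[lt_ij le_jc]; exists (nth a s i), (take (j - i).-1 (drop i.+1 s)).
  rewrite -[in LHS](subnKC (ltnW lt_ij)) takeD; congr (_ ++ _).
  rewrite (drop_nth a) ?sz_s ?(leq_trans lt_ij) //.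
  by move: lt_ij; rewrite -subn_gt0; case: (j - i)%N.
have pre_lt (i j : 'I_c.+1) : (i < j)%N -> pre i != pre j.
  move=> lt_ij; apply/eqP => eq_ij; have /eqP[] := pre_neq0 i.
  have [|b [t tj]] := take_lt i j; first by rewrite lt_ij -ltnS ltn_ord.
  apply: (nilpotent_fix_eq0 (foldl *%g b t) vanish).
  by rewrite {1}eq_ij foldl_mulg -tj.
have pre_inj : injective pre.
  move=> i j eq_ij; apply/val_inj/eqP; case: ltngtP => // /pre_lt/eqP[] //.
have codomE : codom pre =i [pred x : S | x != zerog].
  apply/subset_cardP; first by rewrite card_codom // card_ord cardS.
  by apply/subsetP => _ /codomP[i ->]; apply: pre_neq0.
have /codomP[i ->] : x \in codom pre by rewrite codomE.
exists i => // i_gt0; have [|b [t ti]] := take_lt 0%N i.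
  by rewrite i_gt0 -ltnS ltn_ord.
by exists a, [:: foldl *%g b t]; rewrite /pre ti take0 -foldl_mulg.
Qed.

(** A letter [y] of the longest non-zero product is itself a prefix.  If it is
    not the first letter, then it is some [u * v], and replacing [y] by [u, v]
    gives the same product with one factor more than [S] allows. *)
Lemma longest_product_const {c a s} :
    products_vanish (zerog : S) c.+1 -> #|[pred x : S | x != zerog]| = c.+1 ->
    size s = c -> foldl *%g a s != zerog ->
  s = nseq c a.
Proof.
move=> vanish cardS sz_s prod_neq0; rewrite -[in RHS]sz_s.
apply/all_pred1P/allP => y y_s /=; apply/eqP.
have onto := prefix_onto vanish cardS sz_s prod_neq0.
case/path.splitPr: y_s sz_s prod_neq0 onto => s1 s2 sz_s prod_neq0 onto.
have y_neq0: y != zerog.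
  by apply: contraNneq prod_neq0 => ->; rewrite foldl_cat /= mulg0 foldl_zero.
have [i yE prod2] := onto y y_neq0.
case: (posnP i) => [i0|/prod2]; first by rewrite yE i0 take0.
case=> u [[|v [|w t]] [//= _ yuv]] //.
have /eqP[] := prod_neq0; apply: vanish.
exists a, (s1 ++ u :: v :: s2); split.
  by move: sz_s; rewrite !size_cat /= !addnS => ->.
by rewrite !foldl_cat /= yuv mulgA.
Qed.

End NilpotentSemigroup.

(** [S = {a, a^2, ..., a^c, 0}] with these [c + 1] elements distinct; index [c]
    of the bijection stands for [a^(c+1) = 0].  For [c = 0] the generator is the
    zero itself. *)
Definition nil_monogenic (c : nat) (S : finSemigroup0Type) : Prop :=
  exists a : S, bijective (fun i : 'I_c.+1 => spow a i) /\ spow a c = zerog.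

Lemma coclass0_nil_monogenic (S : finSemigroup0Type) :
  sgrp_coclass S 0 -> nil_monogenic #|[pred x : S | x != zerog]| S.
Proof.
case=> c [vanish least]; rewrite addn0 => cardS; rewrite cardS.
case: c => [|c] in vanish least cardS *.
  exists zerog; split=> //; exists (fun=> ord0) => x; first by rewrite [RHS]ord1.
  by apply/esym/vanish; exists x, [::].
have [a [s [sz_s prod_neq0]]] :
    exists (a : S) s, size s = c /\ foldl *%g a s != zerog.
  apply: contrapT => all0; suff: products_vanish (zerog : S) c.
    by move/least; rewrite ltnn.
  move=> x [a [s [[sz_s] ->]]]; apply/eqP/negP => /negP neq0.
  by apply: all0; exists a, s.
have s_const := longest_product_const vanish cardS sz_s prod_neq0.
have ac0 : spow a c.+1 = zerog by apply: vanish; apply: spow_product.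
exists a; split=> //.
have onto x : exists i : 'I_c.+2, x = spow a i.
  have [->|x_neq0] := eqVneq x zerog; first by exists ord_max.
  have [i ->] := prefix_onto vanish cardS sz_s prod_neq0 x x_neq0.
  exists (widen_ord (leqnSn _) i); rewrite s_const /spow /= take_nseq //.
  by rewrite -ltnS.
have cardSS : #|S| = c.+2.
  rewrite (cardD1 (zerog : S)) -cardS inE add1n; congr _.+1.
  by apply: eq_card => x; rewrite !inE andbT.
apply: inj_card_bij; last by rewrite cardSS card_ord.
have /image_injP inj :
    #|image (fun i : 'I_c.+2 => spow a i) 'I_c.+2| == #|'I_c.+2|.
  rewrite card_ord -[X in _ == X]cardSS; apply/eqP/eq_card => x.
  by have [k ->] := onto x; apply/imageP; exists k.
by move=> i j; apply: inj.
Qed.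

(** The product of powers is the same function of the exponents in [S] and [T],
    once exponents above [c + 1] are cut down to [c + 1]. *)
Lemma nil_monogenic_isog c (S T : finSemigroup0Type) :
  nil_monogenic c S -> nil_monogenic c T -> sgrp_isog S T.
Proof.
have powM (U : finSemigroup0Type) (u : U) : spow u c = zerog ->
    forall i j : 'I_c.+1, (spow u i * spow u j)%g
                        = spow u (inord (minn (i + j).+1 c) : 'I_c.+1).
  move=> uc0 i j; rewrite inordK ?ltnS ?geq_minr // spowD.
  case: (leqP (i + j).+1 c) => // /ltnW le_c.
  by rewrite uc0 (spow_ge uc0).
case=> a [[g gK Kg] ac0] [b [b_bij bc0]].
exists (fun x => spow b (g x)).
  by apply: (bij_comp b_bij); exists (fun i : 'I_c.+1 => spow a i).
move=> x y; rewrite (powM T) //; congr (spow b (val _)).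
by rewrite -[in LHS](Kg x) -[in LHS](Kg y) powM // gK.
Qed.

(** The model [{a, a^2, ..., a^c, 0}]: [i] stands for [a^(i+1)], and [c] for 0. *)
Definition trunc_sgrp (c : nat) : Type := 'I_c.+1.

HB.instance Definition _ c := Finite.on (trunc_sgrp c).

Section TruncatedSemigroup.
Variable c : nat.
Local Notation M := (trunc_sgrp c).

Definition trunc_mul (i j : M) : M := inord (minn (i + j).+1 c).

Lemma val_trunc_mul i j : trunc_mul i j = minn (i + j).+1 c :> nat.
Proof. by rewrite inordK // ltnS geq_minr. Qed.

Fact trunc_mulA : associative trunc_mul.
Proof.
move=> i j k; apply: val_inj; rewrite /= !val_trunc_mul.
lia.
Qed.
HB.instance Definition _ := isSemigroup.Build M trunc_mulA.

Fact trunc_mul0g : left_zero (ord_max : M) (@monoid.mul M).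
Proof.
by move=> i; apply: val_inj; rewrite /= val_trunc_mul (minn_idPr _) ?leqW ?leq_addr.
Qed.
Fact trunc_mulg0 : right_zero (ord_max : M) (@monoid.mul M).
Proof.
by move=> i; apply: val_inj; rewrite /= val_trunc_mul (minn_idPr _) ?leqW ?leq_addl.
Qed.
HB.instance Definition _ :=
  Semigroup_hasZero.Build M trunc_mul0g trunc_mulg0.

Lemma trunc_spow n : spow (ord0 : M) n = minn n c :> nat.
Proof.
elim: n => [|n IHn]; first by rewrite min0n.
rewrite -[n]addn0 -spowD val_trunc_mul IHn addn0 /=; lia.
Qed.

Lemma trunc_product {n} (x : M) : is_product n.+1 x -> (minn n c <= x)%N.
Proof.
case=> a [s [[<-] ->]]; elim/last_ind: s => [|s y IHs] /=; first by rewrite min0n.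
rewrite size_rcons foldl_rcons val_trunc_mul leq_min geq_minr andbT.
apply: (@leq_trans (minn (size s) c).+1).
  by rewrite -minnSS leq_min geq_minl /= geq_min leqnSn orbT.
by rewrite ltnS (leq_trans IHs) ?leq_addr.
Qed.

Lemma card_trunc_sgrp : #|[pred x : M | x != zerog]| = c.
Proof. by rewrite (cardC1 (ord_max : 'I_c.+1)) card_ord. Qed.

Lemma trunc_coclass0 : sgrp_coclass M 0.
Proof.
exists c; last by rewrite addn0 card_trunc_sgrp.
split=> [x /trunc_product|c' /(_ _ (spow_product (ord0 : M) c'))/(congr1 val)].
  rewrite minnn => le_cx; apply: val_inj; apply/eqP.
  by rewrite eqn_leq -ltnS ltn_ord.
by rewrite /= trunc_spow => /minn_idPr.
Qed.

End TruncatedSemigroup.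

(** * The algebras [x K[x] / (x^(c+1))] *)

Section TruncatedAlgebra.
Local Open Scope quotient_scope.
Context {K : fieldType}.
Implicit Types (A B : nualgType K) (p q : {poly K}) (c m n : nat).

(** [A] is isomorphic to [x K[x] / (x^(c+1))], [phi p] being the image of [x * p]:
    this explains the extra ['X] in the product, and why [p] counts modulo [x^c]. *)
Definition truncated c A : Prop :=
  exists phi : {linear {poly K} -> A},
  [/\ forall x, exists p, x = phi p,
      forall p q, (phi p * phi q)%g = phi ('X * p * q)
    & forall p q, phi p = phi q <-> take_poly c p = take_poly c q].

Lemma truncatedI c A (phi : {poly K} -> A) : linear phi ->
    (forall x, exists p, x = phi p) ->
    (forall p q, (phi p * phi q)%g = phi ('X * p * q)) ->
    (forall p q, phi p = phi q <-> take_poly c p = take_poly c q) ->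
  truncated c A.
Proof.
move=> phi_lin surj mult ker.
pose phiL : {linear {poly K} -> A} :=
  HB.pack phi (GRing.isLinear.Build _ _ _ _ phi phi_lin).
by exists phiL.
Qed.

(** Both algebras are [K[x]] modulo the same polynomials, with the same product. *)
Lemma truncated_isog c A B : truncated c A -> truncated c B -> nualg_isog A B.
Proof.
case=> phi [phi_surj phiM phi_ker] [psi [psi_surj psiM psi_ker]].
have [s sK] := choice phi_surj; have [t tK] := choice psi_surj.
have psi_s p : psi (s (phi p)) = psi p.
  by apply/psi_ker/phi_ker; rewrite -sK.
have phi_t p : phi (t (psi p)) = phi p.
  by apply/phi_ker/psi_ker; rewrite -tK.
exists (psi \o s); split=> [|k x y|x y] /=.
- exists (phi \o t) => x /=; first by rewrite phi_t -sK.
  by rewrite psi_s -tK.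
- by rewrite {1}(sK x) {1}(sK y) -linearP psi_s linearP.
- by rewrite {1}(sK x) {1}(sK y) phiM psi_s psiM.
Qed.

Lemma isog_truncated c A B : truncated c A -> nualg_isog A B -> truncated c B.
Proof.
case=> phi [phi_surj phiM phi_ker] [f [[g fK gK] f_lin fM]].
apply: (truncatedI c B (f \o phi)) => /=.
- by move=> k p q /=; rewrite linearP f_lin.
- by move=> x; have [p gx] := phi_surj (g x); exists p; rewrite -gx gK.
- by move=> p q; rewrite -phiM fM.
- by move=> p q; rewrite -phi_ker; split=> [/(can_inj fK)|->].
Qed.

(** As [phi q] is the image of [x * q], a product of [n + 1] elements is the image
    of a multiple of [x^(n+1)], and conversely [x^(n+1) * q] is [x * q] times [n]
    factors [x].  In particular the products already form a linear subspace. *)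
Lemma truncated_product c A (phi : {linear {poly K} -> A}) n (x : A) :
    (forall x, exists p, x = phi p) ->
    (forall p q, (phi p * phi q)%g = phi ('X * p * q)) ->
  is_product n.+1 x <-> exists q, x = phi (q * 'X^n).
Proof.
move=> surj phiM; split=> [[a [s [[<-] ->]]]|[q ->]].
  elim/last_ind: s => [|s y [q IHs]].
    by have [q ->] := surj a; exists q; rewrite mulr1.
  have [q' ->] := surj y; exists (q * q').
  rewrite size_rcons foldl_rcons IHs phiM exprS mulrCA -!mulrA.
  by congr (phi (_ * _)); rewrite mulrA mulrC.
exists (phi q), (nseq n (phi 1)); rewrite size_nseq; split=> //.
elim: n q => [|n IHn] q; first by rewrite mulr1.
by rewrite /= phiM mulr1 -IHn exprS mulrCA mulrA.
Qed.

Lemma take_poly_Xn0 c m :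
  (forall q, take_poly c (q * 'X^m) = 0) <-> (c <= m)%N.
Proof.
split=> [take0|le_cm q].
  rewrite leqNgt; apply/negP => lt_mc; move/polyP/(_ m): (take0 1).
  by rewrite coef_take_poly lt_mc mul1r coefXn eqxx coef0 => /eqP; rewrite oner_eq0.
by rewrite take_polyMXn (eqP le_cm) take_poly0l mul0r.
Qed.

Lemma truncated_vanish c A m :
  truncated c A -> products_vanish (0 : A) m <-> (c <= m)%N.
Proof.
case=> phi [surj phiM ker]; rewrite -take_poly_Xn0.
have vanishE q : phi (q * 'X^m) = 0 <-> take_poly c (q * 'X^m) = 0.
  by rewrite -(linear0 phi) ker take_poly0r.
split=> [vanish q|take0 x].
  by apply/vanishE/vanish/(truncated_product c A phi m _ surj phiM); exists q.
by case/(truncated_product c A phi m _ surj phiM) => q ->; apply/vanishE/take0.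
Qed.

Lemma truncated_class c A m : truncated c A -> has_class (0 : A) m <-> m = c.
Proof.
move=> trA; split=> [[/(truncated_vanish _ _ _ trA) le_cm least]|->].
  apply/eqP; rewrite eqn_leq le_cm andbT; apply: least.
  by apply/(truncated_vanish _ _ _ trA).
by split=> [|m']; rewrite (truncated_vanish _ _ _ trA).
Qed.

Lemma truncated_inj c d A : truncated c A -> truncated d A -> c = d.
Proof. by move=> trc trd; apply/(truncated_class d A c trd)/(truncated_class c A c trc). Qed.

Lemma mem_nupower_image c A (phi : {linear {poly K} -> A}) p :
    (forall x, exists p, x = phi p) ->
    (forall p q, (phi p * phi q)%g = phi ('X * p * q)) ->
  phi p \in nupower A c.+1 <-> exists q, phi p = phi (q * 'X^c).
Proof.
move=> surj phiM; have prodE := truncated_product c A phi c _ surj phiM.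
split=> [/asboolP[n [k [x [xP ->]]]]|/prodE prod_p].
  have [q xE] := choice (fun i => (prodE _).1 (xP i)).
  exists (\sum_(i < n) k i *: q i); rewrite mulr_suml linear_sum.
  by apply: eq_bigr => i _; rewrite xE -scalerAl linearZ.
apply/asboolP; exists 1%N, (fun=> 1), (fun=> phi p); split=> //.
by rewrite big_ord1 scale1r.
Qed.

(** The [c+1]-st power is the line spanned by [x^(c+1)], the image under [phi] of
    the multiples of [x^c]; dividing by it replaces [x^(c+2)] by [x^(c+1)]. *)
Lemma truncated_quotient c A :
  truncated c.+1 A -> truncated c (nuquot (nupower A c.+1)).
Proof.
case=> phi [surj phiM ker].
pose Q : nualgType K := nuquot (nupower A c.+1).
apply: (truncatedI c Q (fun p => \pi_(nuquot (nupower A c.+1)) (phi p) : Q)).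
- by move=> k p q; rewrite linearP pi_nuquotD pi_nuquotZ.
- move=> x; have [p xE] := surj (repr x); exists p.
  by rewrite -xE reprK.
- by move=> p q; rewrite -pi_nuquotM phiM.
move=> p q; rewrite pi_nuquotE -linearB (mem_nupower_image _ _ phi) //.
have -> : (take_poly c p = take_poly c q) <-> take_poly c (p - q) = 0.
  by rewrite linearB /=; split=> [->|/eqP]; rewrite ?subrr // subr_eq0 => /eqP.
have take_take r : take_poly c (take_poly c.+1 r) = take_poly c r.
  apply/polyP => i; rewrite !coef_take_poly.
  by case: ifP => // /ltnW; rewrite -ltnS => ->.
split=> [[r /ker/(congr1 (take_poly c))]|take0].
  by rewrite !take_take take_polyMXn_0.
exists (drop_poly c (p - q)).
by rewrite -[in LHS](poly_take_drop c (p - q)) take0 add0r.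
Qed.
End TruncatedAlgebra.

Section ContractedAlgebra.
Local Open Scope quotient_scope.

Lemma pi_nuquot_sum {K : fieldType} {A : nualgType K} (I : nuideal A)
    (n : nat) (F : 'I_n -> A) :
  \pi_(nuquot I) (\sum_i F i) = \sum_i \pi_(nuquot I) (F i).
Proof.
have pi0 : \pi_(nuquot I) 0 = 0 by rewrite -(scale0r (0 : A)) pi_nuquotZ scale0r.
by elim/big_rec2: _ => [|i x y _ <-]; rewrite ?pi0 // pi_nuquotD.
Qed.

(** The powers [a, ..., a^c] give a basis [e_0, ..., e_(c-1)] of the contracted
    algebra, and [e_i * e_j = e_(i+j+1)] with [e_i = 0] for [i >= c]; so [e_i] is
    the image of [x * x^i]. *)
Lemma contracted_truncated (K : fieldType) (c : nat) (S : finSemigroup0Type) :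
  nil_monogenic c S -> truncated c (contracted_alg K S).
Proof.
case=> a [a_bij ac0]; pose Q := contracted_alg K S.
pose e i : Q := \pi_(nuquot (zero_line K S)) (sgrp_basis K (spow a i)).
have e_ge i : (c <= i)%N -> e i = 0.
  move=> le_ci; rewrite /e (spow_ge ac0 le_ci).
  rewrite -(scale0r (e 0%N)) -pi_nuquotZ scale0r; apply/pi_nuquotE.
  by rewrite subr0; apply/asboolP; exists 1; rewrite scale1r.
have eM i j : (e i * e j)%g = e (i + j).+1.
  by rewrite -pi_nuquotM sgrp_basisM spowD.
pose phi (p : {poly K}) : Q := \sum_(i < c) p`_i *: e i.
pose rep (p : {poly K}) : sgrp_alg K S :=
  \sum_(i < c) p`_i *: sgrp_basis K (spow a i).
have phi_rep p : phi p = \pi_(nuquot (zero_line K S)) (rep p).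
  by rewrite pi_nuquot_sum; apply: eq_bigr => i _; rewrite pi_nuquotZ.
have spow_eq i j : (i <= c)%N -> (j <= c)%N -> (spow a i == spow a j) = (i == j).
  rewrite -[(i <= c)%N]ltnS -[(j <= c)%N]ltnS => lt_i lt_j.
  exact: (inj_eq (bij_inj a_bij) (Ordinal lt_i) (Ordinal lt_j)).
have rep_coef p j : (j < c)%N -> rep p (spow a j) = p`_j.
  move=> lt_jc; rewrite sum_ffunE (bigD1 (Ordinal lt_jc)) //= big1 => [|i ne_ij].
    by rewrite !ffunE eqxx [_ *: _]mulr1 addr0.
  rewrite !ffunE spow_eq ?(ltnW lt_jc) ?(ltnW (ltn_ord i)) //.
  rewrite eq_sym -[(i == j :> nat)]/(i == Ordinal lt_jc) (negPf ne_ij).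
  by rewrite [_ *: _]mulr0.
have phi_lin : linear phi.
  move=> k p q; rewrite /phi scaler_sumr -big_split; apply: eq_bigr => i _.
  by rewrite coefD coefZ scalerDl scalerA.
pose phiL : {linear {poly K} -> Q} :=
  HB.pack phi (GRing.isLinear.Build _ _ _ _ phi phi_lin).
have phiXn n : phiL 'X^n = e n.
  rewrite /= /phi; have [lt_nc|le_cn] := ltnP n c.
    rewrite (bigD1 (Ordinal lt_nc)) //= coefXn eqxx scale1r big1 ?addr0 //.
    move=> i ne_in; rewrite coefXn -[(i == n :> nat)]/(i == Ordinal lt_nc).
    by rewrite (negPf ne_in) scale0r.
  rewrite e_ge // big1 // => i _.
  by rewrite coefXn ltn_eqF ?scale0r // (leq_trans (ltn_ord i)).
have phi_sum p : phiL p = \sum_(i < size p) p`_i *: e i.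
  rewrite -[p in LHS]coefK poly_def linear_sum; apply: eq_bigr => i _.
  by rewrite linearZ /= -phiXn.
apply: (truncatedI c Q phi) => // [x|p q|p q].
- exists (\poly_(i < c) repr x (spow a i)).
  rewrite -[LHS]reprK [in LHS](sgrp_algE (repr x)).
  rewrite (reindex _ (onW_bij _ a_bij)) pi_nuquot_sum big_ord_recr /=.
  rewrite pi_nuquotZ -[X in _ + _ *: X]/(e c) e_ge // scaler0 addr0.
  by apply: eq_bigr => i _; rewrite pi_nuquotZ coef_poly ltn_ord.
- rewrite -[phi p]/(phiL p) -[phi q]/(phiL q) -[RHS]/(phiL _).
  rewrite (phi_sum p) (phi_sum q) -[p in RHS]coefK -[q in RHS]coefK !poly_def.
  rewrite numul_suml ['X * _]mulr_sumr mulr_suml linear_sum; apply: eq_bigr => i _.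
  rewrite numul_sumr mulr_sumr linear_sum; apply: eq_bigr => j _.
  rewrite numulZl numulZr eM -!scalerAr -scalerAl !linearZ /= -[phi _]/(phiL _).
  by rewrite -exprS -exprD phiXn addSn.
split=> [phi_eq|/polyP eq_pq].
  apply/polyP => j; rewrite !coef_take_poly; case: ifP => // lt_jc.
  (* Equal images differ by a multiple of the zero of [S], which is not a power
     [a^(j+1)] with [j < c]; so their coordinates at that power agree. *)
  move: phi_eq; rewrite !phi_rep => /pi_nuquotE/asboolP[k /ffunP/(_ (spow a j))].
  rewrite !ffunE !rep_coef // -ac0 spow_eq ?(ltnW lt_jc) // ltn_eqF //.
  by rewrite [_ *: _]mulr0 => /eqP; rewrite subr_eq0 => /eqP.
by apply: eq_bigr => i _; have := eq_pq i; rewrite !coef_take_poly ltn_ord => ->.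
Qed.

End ContractedAlgebra.

(** * Digraphs that are a ray *)

Section Ray.
Context {G : labelled_digraph}.
Implicit Types (A B C : G) (v p : nat -> G).

Definition is_ray v : Prop :=
  (forall A, exists i, A = v i) /\
  (forall i j, edge (v i) (v j) <-> j = i.+1).

Context {v} (v_ray : is_ray v).

Let v_onto : forall A, exists i, A = v i. Proof. by case: v_ray. Qed.
Let v_edge : forall i j, edge (v i) (v j) <-> j = i.+1.
Proof. by case: v_ray. Qed.

(** The successors of equal vertices agree, and determine their positions. *)
Lemma ray_inj : injective v.
Proof.
move=> i j eq_ij; have /v_edge : edge (v j) (v i.+1) by rewrite -eq_ij v_edge.
by case.
Qed.

Lemma ray_tree i j : tree (v i) (v j) <-> (i <= j)%N.
Proof.
split=> [|/subnKC <-]; last first.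
  elim: (j - i)%N => [|n IHn]; first by rewrite addn0; apply: rt_refl.
  by apply: rt_trans IHn _; apply: rt_step; rewrite v_edge addnS.
suff mono A B : tree A B -> forall m n, A = v m -> B = v n -> (m <= n)%N.
  by move/mono; apply.
elim=> [C D CD|C|C D E _ IHCD _ IHDE] m n.
- by move=> Cm Dn; move: CD; rewrite Cm Dn v_edge => ->.
- by move=> -> /ray_inj ->.
have [k Dk] := v_onto D => Cm En.
exact: leq_trans (IHCD _ _ Cm Dk) (IHDE _ _ Dk En).
Qed.

Lemma ray_root i : is_root (v i) <-> i = 0%N.
Proof.
split=> [root_i|-> B]; last by have [j ->] := v_onto B; rewrite v_edge.
by case: i root_i => // i /(_ (v i)); rewrite v_edge => /(_ erefl).
Qed.

Lemma ray_path p i : infinite_path_from (v i) p -> forall n, p n = v (i + n)%N.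
Proof.
case=> p_path p0 n; elim: n => [|n IHn]; first by rewrite addn0.
have [j pj] := v_onto (p n.+1); have := p_path n.
by rewrite pj IHn v_edge addnS => ->.
Qed.

Lemma ray_maximal_path p : maximal_infinite_path p -> p = v.
Proof.
case=> p_path; have [i p0] := v_onto (p 0%N); rewrite p0 ray_root => i0.
by apply/funext => n; rewrite (ray_path p i) // i0.
Qed.

Lemma ray_coclass_tree : coclass_tree (v 0%N).
Proof.
split; last first.
  exists v; split=> [|p /ray_path p_eq]; first by split=> // i; rewrite v_edge.
  by apply/funext => n; rewrite p_eq.
split=> [B _|B C D _ _]; first exact: (ray_root 0).2.
have [[i ->] [j ->]] := (v_onto B, v_onto C); have [k ->] := v_onto D.
by rewrite !v_edge => -> [->].
Qed.

(** A tree with another root would be maximal only if two different maximal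
    infinite paths met above it, but the ray is the only one. *)
Lemma ray_maximal_coclass_tree A : maximal_coclass_tree A <-> A = v 0%N.
Proof.
split=> [[_ [rootA|[B [_ [p [q [p_max q_max neq_pq _ _]]]]]]]|->].
- by have [i Ai] := v_onto A; move: rootA; rewrite Ai ray_root => ->.
- by case: neq_pq; rewrite (ray_maximal_path _ p_max) (ray_maximal_path _ q_max).
by split; [apply: ray_coclass_tree | left; apply/ray_root].
Qed.

Lemma ray_fundamental_domain B :
  tree (v 0%N) B /\ ~ tree (v 1%N) B <-> B = v 0%N.
Proof.
have [j ->] := v_onto B; rewrite !ray_tree.
split=> [[_ /negP]|/ray_inj ->]; last by split.
by rewrite -leqNgt leqn0 => /eqP ->.
Qed.

(** The isomorphism is the shift [v i -> v i.+1]; its iterates carry the root to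
    every vertex. *)
Lemma ray_periodic : (forall i, has_label (v i) 1) ->
  strongly_virtually_periodic (v 0%N) 1 1 (fun=> 1).
Proof.
move=> label1; split=> //; exists v; split; first by split=> // i; rewrite v_edge.
have [lvl lvlK] := choice v_onto; have vK i : lvl (v i) = i by apply: ray_inj.
exists (fun B => v (lvl B).+1); split=> [|B in0 not_in1 i]; last first.
  have -> : B = v 0%N by apply/ray_fundamental_domain.
  exists 1%N; last by rewrite hornerC.
  by suff -> : iter i (fun B => v (lvl B).+1) (v 0%N) = v i => //;
    elim: i => //= i ->; rewrite vK.
split=> [B _|B C _ _ /ray_inj[]|C|B C _ _] /=.
- by rewrite ray_tree.
- by move=> eq_lvl; rewrite (lvlK B) (lvlK C) eq_lvl.
- rewrite (lvlK C) ray_tree; case: (lvl C) => // n _.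
  by exists (v n); rewrite ?ray_tree // vK.
by rewrite {1}(lvlK B) {1}(lvlK C) !v_edge; split=> [->|[]].
Qed.

End Ray.

(** * The graph of coclass 0 *)

Section CoclassZero.
Variable K : fieldType.
Implicit Types (A B : nualgType K) (S T : finSemigroup0Type).

Lemma coclass0_truncated S : sgrp_coclass S 0 ->
  truncated #|[pred x : S | x != zerog]| (contracted_alg K S).
Proof. by move=> S0; apply/contracted_truncated/coclass0_nil_monogenic. Qed.

Lemma contracted_trunc_sgrp c : truncated c (contracted_alg K (trunc_sgrp c)).
Proof.
by have := coclass0_truncated _ (trunc_coclass0 c); rewrite card_trunc_sgrp.
Qed.

Lemma iso_type_truncated c A B : truncated c A -> iso_type A B <-> truncated c B.
Proof.
by move=> trA; split=> [/(isog_truncated _ _ _ trA)|/(truncated_isog _ _ _ trA)].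
Qed.

Definition vertex_at c : coclass_graph 0 K := vertex_of K (trunc_coclass0 c).

Lemma vertex_atE c B : sval (vertex_at c) B <-> truncated c B.
Proof. exact/iso_type_truncated/contracted_trunc_sgrp. Qed.

(** A vertex is a predicate on algebras; for [S] of coclass 0 with [c] non-zero
    elements it is [truncated c], since [truncated c] determines an algebra up to
    isomorphism. *)
Lemma coclass0_vertexE (A : coclass_graph 0 K) S :
    sgrp_coclass S 0 -> sval A = iso_type (contracted_alg K S) ->
  A = vertex_at #|[pred x : S | x != zerog]|.
Proof.
move=> S0 AS; apply: eq_sig_hprop => [? ? ?|]; first exact: Prop_irrelevance.
apply/funext => B; apply/propext; rewrite vertex_atE AS.
exact/iso_type_truncated/coclass0_truncated.
Qed.

(** The class of a representative of [vertex_at j] is [j], so the quotient that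
    defines an edge is by the [j]-th power, and it lowers the class by one. *)
Lemma vertex_at_edge i j : edge (vertex_at i) (vertex_at j) <-> j = i.+1.
Proof.
split=> [[B [c [/vertex_atE trB]]]|->].
  move/(truncated_class _ _ _ trB) => ->.
  case: j trB => // j /truncated_quotient trQ _ /vertex_atE trQ'.
  by rewrite (truncated_inj _ _ _ trQ trQ').
have trM := contracted_trunc_sgrp i.+1.
exists (contracted_alg K (trunc_sgrp i.+1)), i.+1; split=> //.
- exact/vertex_atE/trM.
- exact/(truncated_class _ _ _ trM).
exact/vertex_atE/truncated_quotient.
Qed.

Lemma vertex_at_ray : is_ray vertex_at.
Proof.
split=> [A|]; last exact: vertex_at_edge.
have [S S0 AS] := svalP A; exists #|[pred x : S | x != zerog]|.
exact: coclass0_vertexE AS.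
Qed.

(** [K T] determines the class of [T], hence, in coclass 0, also [T]. *)
Lemma vertex_at_label c : has_label (vertex_at c) 1.
Proof.
have nilM := coclass0_nil_monogenic _ (trunc_coclass0 c).
rewrite card_trunc_sgrp in nilM.
exists (fun=> trunc_sgrp c); split=> [_|i j _|T [T0 /vertex_atE trT]].
- split; first exact: trunc_coclass0.
  exact/vertex_atE/contracted_trunc_sgrp.
- by rewrite !ord1.
exists ord0; apply: nil_monogenic_isog nilM.
rewrite (truncated_inj _ _ _ trT (coclass0_truncated _ T0)).
exact: coclass0_nil_monogenic.
Qed.

Lemma KZ1_vertex_at : KZ1 K = vertex_at 0.
Proof.
rewrite (coclass0_vertexE (KZ1 K) _ zero_sgrp1_coclass) //; congr vertex_at.
by apply: eq_card0 => x; rewrite !inE [x]ord1 eqxx.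
Qed.

End CoclassZero.

Theorem theorem7 (K : fieldType) :
  [/\ maximal_coclass_tree (KZ1 K),
      forall A : coclass_graph 0 K, maximal_coclass_tree A -> A = KZ1 K,
      forall B : coclass_graph 0 K, tree (KZ1 K) B
    & exists f : coclass_graph 0 K -> {poly rat},
      [/\ strongly_virtually_periodic (KZ1 K) 1 1 f,
          forall p, infinite_path_from (KZ1 K) p ->
            forall B, (tree (p 0%N) B /\ ~ tree (p 1%N) B) <-> B = KZ1 K
        & f (KZ1 K) = 1]].
Proof.
have ray := vertex_at_ray K; rewrite KZ1_vertex_at; split.
- exact/(ray_maximal_coclass_tree ray).
- by move=> A; rewrite (ray_maximal_coclass_tree ray).
- by move=> B; have [i ->] := ray.1 B; apply/(ray_tree ray).
exists (fun=> 1); split=> //.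
- exact: ray_periodic ray (vertex_at_label K).
move=> p /(ray_path ray) p_eq B.
by rewrite !p_eq; apply: ray_fundamental_domain.
Qed.
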